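(* Let $\mathbb K$ be a field, $A$ a unitary commutative $\mathbb K$-algebra, $(\mathfrak g,[-,-]_{\mathfrak g})$ a finite dimensional Lie $\mathbb K$-algebra, $\lambda:\mathfrak g\to \mathrm{Der}(A)$ a Lie $\mathbb K$-algebra homomorphism (an action of $\mathfrak g$ on $A$), and $r=\sum_i x_i\wedge y_i\in\mathfrak g\wedge\mathfrak g$ an $r$-matrix. For $a,b\in A$ put $$\{a,b\}=\sum_i\big(\lambda(x_i)(a)\lambda(y_i)(b)-\lambda(x_i)(b)\lambda(y_i)(a)\big).$$ Let $\Omega^1$ be the module of Kähler differentials of $A$ over $\mathbb K$ with universal derivation $d$, and for $a,b,u,v\in A$ define $$\pi_r^\sharp(a\,du)(v)=a\{u,v\},$$ $$(a\,du)\cdot_{\Omega^1}(b\,dv)=ab\sum_i\big(\lambda(x_i)(u)\,d\lambda(y_i)(v)-\lambda(y_i)(u)\,d\lambda(x_i)(v)\big)+a\{u,b\}\,dv.$$ Then $(\Omega^1,\cdot_{\Omega^1},\pi_r^\sharp)$ is a pre-Lie-Rinehart algebra over $A$, and its sub-adjacent Lie-Rinehart algebra is $(\Omega^1,[-,-]_{\Omega^1},\pi_r^\sharp)$, where $$[a\,du,b\,dv]_{\Omega^1}=a\{u,b\}\,dv+b\{a,v\}\,du+ab\,d\{u,v\}.$$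
   Context: $\mathrm{Der}(A)$ is the $A$-module of $\mathbb K$-linear derivations of $A$, a Lie $\mathbb K$-algebra under the commutator $[D_1,D_2]^c=D_1D_2-D_2D_1$. $\Omega^1$ is the $A$-module representing $\mathcal M\mapsto \mathrm{Der}_{\mathbb K}(A,\mathcal M)$; its elements are finite sums of terms $a\,db$ with $d(ab)=(da)b+a\,db$; and $\mathrm{Der}(A)\cong\mathrm{Hom}_A(\Omega^1,A)$. An element $r=\sum_i x_i\wedge y_i\in\mathfrak g\wedge\mathfrak g$ is an $r$-matrix if $$\sum_{i,j}\big([x_i,x_j]_{\mathfrak g}\wedge y_i\wedge y_j+2x_i\wedge[y_i,x_j]_{\mathfrak g}\wedge y_j+x_i\wedge x_j\wedge[y_i,y_j]_{\mathfrak g}\big)=0 .$$ A pre-Lie $\mathbb K$-algebra is a $\mathbb K$-vector space with a $\mathbb K$-bilinear product whose associator $(x,y,z)=x(yz)-(xy)z$ satisfies $(x,y,z)=(y,x,z)$. A pre-Lie-Rinehart algebra $(E,\cdot_E,\theta_E)$ over $A$ is an $A$-module $E$ with an $A$-module map $\theta_E:E\to\mathrm{Der}(A)$ (the anchor) and a ($\mathbb K$-bilinear) pre-Lie product $\cdot_E$ on $E$ such that for all $X,Y\in E$, $a\in A$: $X\cdot_E(aY)=a(X\cdot_EY)+\theta_E(X)(a)Y$; $(aX)\cdot_EY=a(X\cdot_EY)$; $\theta_E(X\cdot_EY-Y\cdot_EX)=[\theta_E(X),\theta_E(Y)]^c$. A Lie-Rinehart algebra $(E,[-,-]_E,\theta_E)$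 over $A$ is an $A$-module $E$ with an $A$-module map $\theta_E:E\to\mathrm{Der}(A)$ and a $\mathbb K$-Lie bracket with $[X,aY]_E=a[X,Y]_E+\theta_E(X)(a)Y$ and $\theta_E([X,Y]_E)=[\theta_E(X),\theta_E(Y)]^c$. The sub-adjacent Lie-Rinehart algebra of $(E,\cdot_E,\theta_E)$ is $(E,[-,-]_E,\theta_E)$ with $[X,Y]_E=X\cdot_EY-Y\cdot_EX$.
   Formalization: The field K is assumed to have characteristic different from 2; in characteristic 2 the r-matrix equation as stated holds for every r and the claim fails (e.g. r = x∧y in the Heisenberg algebra acting on F_2[p,q,s]). *)

(* Defs.v *)
From HB Require Import structures.
From mathcomp Require Import all_boot all_order all_algebra.
From mathcomp Require Import boolp functions.
From mathcomp Require Import ring zify.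

Set Implicit Arguments.
Unset Strict Implicit.
Unset Printing Implicit Defensive.

Import GRing.Theory.
Local Open Scope ring_scope.

(* An A-module M seen as a K-vector space through the structure map
   k |-> k%:A of the K-algebra A. *)
Definition restr (K : fieldType) (A : comAlgType K) (M : lmodType A) : Type :=
  M.

Section RestrictionOfScalars.
Context (K : fieldType) (A : comAlgType K) (M : lmodType A).

HB.instance Definition _ := GRing.Zmodule.on (restr M).

Definition restr_scale (k : K) (m : restr M) : restr M := k%:A *: (m : M).

Fact restr_scaleA a b v :
  restr_scale a (restr_scale b v) = restr_scale (a * b) v.
Proof. by rewrite /restr_scale scalerA -scalerAl mul1r scalerA. Qed.

Fact restr_scale1 : left_id 1 restr_scale.
Proof. by move=> v; rewrite /restr_scale !scale1r. Qed.

Fact restr_scaleDr : right_distributive restr_scale +%R.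
Proof. by move=> a u v; rewrite /restr_scale scalerDr. Qed.

Fact restr_scaleDl v : {morph restr_scale^~ v : a b / a + b}.
Proof. by move=> a b; rewrite /restr_scale !scalerDl. Qed.

HB.instance Definition _ := GRing.Zmodule_isLmodule.Build K (restr M)
  restr_scaleA restr_scale1 restr_scaleDr restr_scaleDl.

End RestrictionOfScalars.

Section AlgebrasOverAField.
Context (K : fieldType) (V : lmodType K).
Implicit Type op : V -> V -> V.

Definition bilinear_op op :=
  (forall u, linear (op u)) /\ (forall v, linear (op^~ v)).

Definition lie_bracket op :=
  [/\ bilinear_op op,
      forall u, op u u = 0 &
      forall u v w, op u (op v w) + op v (op w u) + op w (op u v) = 0].

Definition associator op u v w := op u (op v w) - op (op u v) w.

Definition pre_lie_product op :=
  bilinear_op op /\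
  forall u v w, associator op u v w = associator op v u w.

End AlgebrasOverAField.

Definition lie_hom (K : fieldType) (V W : lmodType K)
    (brV : V -> V -> V) (brW : W -> W -> W) (f : V -> W) :=
  linear f /\ {morph f : u v / brV u v >-> brW u v}.

Definition derivation (K : fieldType) (A : comAlgType K) (M : lmodType A)
    (D : A -> M) :=
  linear (D : A -> restr M) /\
  forall a b : A, D (a * b) = b *: D a + a *: D b.

Section DerivationTheory.
Context (K : fieldType) (A : comAlgType K) (M : lmodType A) (D : A -> M).
Hypothesis derD : derivation D.

Fact derivationD a b : D (a + b) = D a + D b.
Proof.
have := derD.1 1 a b; rewrite scale1r => ->.
by rewrite [1 *: (D a : restr M)]scale1r.
Qed.

Fact derivation0 : D 0 = 0.
Proof. by apply: (@addrI _ (D 0)); rewrite -derivationD !addr0. Qed.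

Fact derivationZ (k : K) a : D (k *: a) = k%:A *: D a.
Proof. by have := derD.1 k a 0; rewrite addr0 derivation0 addr0. Qed.

Fact derivationN a : D (- a) = - D a.
Proof.
by apply: (@addrI _ (D a)); rewrite -derivationD !subrr derivation0.
Qed.

End DerivationTheory.

Section Derivations.
Context (K : fieldType) (A : comAlgType K).

(* A^o is A as a module over itself; A -> A^o is an A-module pointwise. *)
Definition der_pred : {pred A -> A^o} :=
  fun D : A -> A^o => `[< derivation D >].

Fact der_submod_closed : submod_closed der_pred.
Proof.
split.
  apply/asboolP; split=> [k a b | a b].
    by rewrite /= scaler0 addr0.
  by rewrite !scaler0 addr0.
move=> c D1 D2 /asboolP[l1 m1] /asboolP[l2 m2]; apply/asboolP; split.
  move=> k a b; rewrite !fctE l1 l2 /GRing.scale /= /restr_scale.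
  rewrite /GRing.scale /= !mulrDr.
  by rewrite !(mulrCA c) addrACA.
move=> a b; rewrite !fctE m1 m2 /GRing.scale /= !mulrDr.
by rewrite !(mulrCA c) addrACA.
Qed.

HB.instance Definition _ :=
  GRing.isSubmodClosed.Build A (A -> A^o) der_pred
    (GRing.subsemimod_closed_submod der_submod_closed).

Record der := Der { der_fun :> A -> A^o; _ : der_fun \in der_pred }.

HB.instance Definition _ := [isSub for der_fun].
HB.instance Definition _ := [Choice of der by <:].
HB.instance Definition _ := [SubChoice_isSubLmodule of der by <:].

Fact der_commutator_subproof (D1 D2 : der) :
  (fun a => D1 (D2 a) - D2 (D1 a)) \in der_pred.
Proof.
case: D1 D2 => [D1 /= /asboolP h1] [D2 /= /asboolP h2].
have Z (D : A -> A) (h : derivation (D : A -> A^o)) k a : D (k *: a) = k *: D a.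
  by rewrite -[RHS]mulr_algl; exact: (derivationZ h).
have M (D : A -> A) (h : derivation (D : A -> A^o)) a b :
    D (a * b) = b * D a + a * D b by exact: h.2.
apply/asboolP; split=> [k a b | a b].
  have -> : forall u v : A, k *: (u : restr A^o) + (v : restr A^o) = k *: u + v.
    by move=> u v; rewrite -[k *: u in RHS]mulr_algl.
  rewrite (derivationD h1) (derivationD h2) (derivationD h1) (derivationD h2).
  by rewrite !(Z _ h1, Z _ h2) scalerBr opprD addrACA.
have -> : forall u v : A, b *: (u : A^o) + a *: (v : A^o) = b * u + a * v by [].
rewrite (M _ h1) (M _ h2) (derivationD h1) (derivationD h2).
rewrite !(M _ h1, M _ h2).
set p := D1 a; set q := D1 b; set p' := D2 a; set q' := D2 b.
ring.
Qed.

Definition der_commutator (D1 D2 : der) : der :=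
  Der (der_commutator_subproof D1 D2).

End Derivations.

(* The pair (Omega, d) represents M |-> Der_K(A, M). *)
Definition kahler_differentials (K : fieldType) (A : comAlgType K)
    (Omega : lmodType A) (d : A -> Omega) :=
  derivation d /\
  forall (M : lmodType A) (D : A -> M), derivation D ->
    exists2 f : {linear Omega -> M},
      forall a, f (d a) = D a &
      forall f' : {linear Omega -> M}, (forall a, f' (d a) = D a) -> f' =1 f.

Section LieRinehart.
Context (K : fieldType) (A : comAlgType K) (E : lmodType A).
Implicit Types (op br : E -> E -> E) (theta : E -> der A).

Definition pre_lie_rinehart op theta :=
  [/\ pre_lie_product (op : restr E -> restr E -> restr E),
      linear theta,
      forall X (a : A) Y, op X (a *: Y) = a *: op X Y + theta X a *: Y,
      forall (a : A) X Y, op (a *: X) Y = a *: op X Y &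
      forall X Y, theta (op X Y - op Y X) = der_commutator (theta X) (theta Y)].

Definition lie_rinehart br theta :=
  [/\ lie_bracket (br : restr E -> restr E -> restr E),
      linear theta,
      forall X (a : A) Y, br X (a *: Y) = a *: br X Y + theta X a *: Y &
      forall X Y, theta (br X Y) = der_commutator (theta X) (theta Y)].

Definition subadjacent op X Y := op X Y - op Y X.

End LieRinehart.

Lemma sum_sorted3 (W : zmodType) N (F : 'I_N -> 'I_N -> 'I_N -> W) :
  (forall i k, F i i k = 0) -> (forall i k, F i k i = 0) ->
  (forall i k, F k i i = 0) ->
  \sum_i \sum_j \sum_k F i j k =
  \sum_i \sum_j \sum_k 
    (F i j k + F j k i + F k i j + F i k j + F j i k + F k j i)
      *+ ((i < j) && (j < k))%N.
Proof.
move=> F1 F2 F3.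
pose S G := \sum_(i < N) \sum_(j < N) \sum_(k < N) G i j k : W.
have SD G H : S (fun i j k => G i j k + H i j k) = S G + S H.
  rewrite /S -big_split; apply: eq_bigr => i _; rewrite -big_split.
  by apply: eq_bigr => j _; rewrite -big_split.
have S12 G : S G = S (fun i j k => G j i k) by rewrite /S exchange_big.
have S23 G : S G = S (fun i j k => G i k j).
  by rewrite /S; apply: eq_bigr => i _; rewrite exchange_big.
have eqS G H : (forall i j k, G i j k = H i j k) -> S G = S H.
  by move=> e; do 3 (apply: eq_bigr => ? _); rewrite e.
pose c (i j k : 'I_N) := ((i < j) && (j < k))%N.
transitivity (S (fun i j k => F i j k *+ c i j k + F i j k *+ c k i j + F i j k *+ c j k i
   + F i j k *+ c i k j + F i j k *+ c j i k + F i j k *+ c k j i)).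
  apply: eqS => i j k; rewrite -!mulrnDr /c.
  have [eij|nij] := eqVneq i j; first by rewrite eij F1 mul0rn.
  have [eik|nik] := eqVneq i k; first by rewrite eik F2 mul0rn.
  have [ejk|njk] := eqVneq j k; first by rewrite ejk F3 mul0rn.
  rewrite -[LHS]mulr1n; congr (_ *+ _); move: nij nik njk; rewrite -!val_eqE /=; lia.
transitivity (S (fun i j k => F i j k *+ c i j k + F j k i *+ c i j k + F k i j *+ c i j k
   + F i k j *+ c i j k + F j i k *+ c i j k + F k j i *+ c i j k)); last first.
  by apply: eqS => i j k; rewrite !mulrnDl.
rewrite !SD; congr (_ + _ + _ + _ + _ + _).
- by rewrite [LHS]S23 [LHS]S12.
- by rewrite [LHS]S12 [LHS]S23.
- by rewrite [LHS]S23.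
- by rewrite [LHS]S12.
- by rewrite [LHS]S12 [LHS]S23 [LHS]S12.
Qed.

Section RMatrix.
Context (K : fieldType) (g : vectType K).

(* The exterior power of order k, in coordinates: v_1 /\ ... /\ v_k is given
   by its k x k minors, i.e. by the entries of the antisymmetric tensor
   sum_sigma sgn(sigma) v_sigma(1) (x) ... (x) v_sigma(k). Without a factor
   1/k! this embeds the exterior power in every characteristic. *)
Definition wedge k (v : k.-tuple g) :
    {ffun {ffun 'I_k -> 'I_(\dim {:g})} -> K} :=
  [ffun s : {ffun 'I_k -> 'I_(\dim {:g})} =>
    \det (\matrix_(i, j) coord (vbasis {:g}) (s j) (tnth v i))].

(* The coordinate model has the universal property of the exterior cube:
   alternating trilinear maps factor linearly through it. *)
Lemma wedge3_universal
    (W : lmodType K)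
    (phi : g -> g -> g -> W) :
  (forall u v, linear (phi u v)) -> (forall u w, linear (fun v => phi u v w)) ->
  (forall v w, linear (fun u => phi u v w)) ->
  (forall u w, phi u u w = 0) -> (forall u w, phi u w u = 0) ->
  (forall u w, phi w u u = 0) ->
  exists2 f : {ffun {ffun 'I_3 -> 'I_(\dim {:g})} -> K^o} -> W,
    linear f & forall u v w, f (wedge [tuple u; v; w]) = phi u v w.
Proof.
move=> l3 l2 l1 a12 a13 a23.
have asum (f : g -> W) (lf : linear f) (I : finType) (c : I -> K) (b : I -> g) :
    f (\sum_i c i *: b i) = \sum_i c i *: f (b i).
  pose fL := HB.pack_for {linear g -> W} f (GRing.isLinear.Build _ _ _ _ f lf).
  rewrite -[f]/(fL : _ -> _) linear_sum; apply: eq_bigr => i _.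
  by rewrite linearZ.
have anti (f : g -> g -> W) : (forall u, linear (f u)) -> (forall v, linear (f^~ v)) ->
    (forall u, f u u = 0) -> forall u v, f v u = - f u v.
  move=> lr ll az u v; have := az (1 *: u + v); rewrite ll !lr !az !scale1r addr0 add0r.
  by move/eqP; rewrite addrC addr_eq0 => /eqP.
pose b := vbasis {:g}; pose N := \dim {:g}.
pose s3 (i j k : 'I_N) : {ffun 'I_3 -> 'I_N} := [ffun m => tnth [tuple i; j; k] m].
pose P (i j k : 'I_N) := phi b`_i b`_j b`_k.
exists (fun c : {ffun {ffun 'I_3 -> 'I_N} -> K^o} =>
   \sum_i \sum_j \sum_k (c (s3 i j k) *: P i j k) *+ ((i < j) && (j < k))%N).
  move=> k u v; rewrite scaler_sumr -big_split; apply: eq_bigr => i _.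
  rewrite scaler_sumr -big_split; apply: eq_bigr => j _.
  rewrite scaler_sumr -big_split; apply: eq_bigr => l _ /=.
  by rewrite !ffunE scalerDl mulrnDl -scalerMnr scalerA.
move=> u v w.
have E t : t = \sum_i coord b i t *: b`_i by rewrite -coord_vbasis // memvf.
have -> : phi u v w = \sum_i \sum_j \sum_k (coord b i u * coord b j v * coord b k w) *: P i j k.
  rewrite {1}(E u) (asum _ (l1 _ _)); apply: eq_bigr => i _.
  rewrite {1}(E v) (asum _ (l2 _ _)) scaler_sumr; apply: eq_bigr => j _.
  rewrite {1}(E w) (asum _ (l3 _ _)) !scaler_sumr; apply: eq_bigr => k _.
  by rewrite !scalerA.
symmetry; rewrite [LHS]sum_sorted3; last 3 first.
- by move=> i k; rewrite /P a12 scaler0.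
- by move=> i k; rewrite /P a13 scaler0.
- by move=> i k; rewrite /P a23 scaler0.
apply: eq_bigr => i _; apply: eq_bigr => j _; apply: eq_bigr => k _.
congr (_ *+ _).
have t12 x y z : phi y x z = - phi x y z by apply: (anti (fun x y => phi x y z)).
have t23 x y z : phi x z y = - phi x y z by apply: (anti (fun y z => phi x y z)).
rewrite /P (t23 b`_j b`_i) (t12 b`_i b`_j) (t12 b`_i b`_k) (t23 b`_i b`_j b`_k).
rewrite (t12 b`_j b`_k b`_i) (t23 b`_j b`_i b`_k) (t12 b`_i b`_j b`_k) !(opprK, scalerN).
rewrite -!scaleNr -!scalerDl; congr (_ *: _).
rewrite !ffunE (expand_det_row _ ord0) !big_ord_recl big_ord0 /cofactor.
rewrite !(expand_det_row _ ord0) !big_ord_recl !big_ord0 /cofactor !det_mx11 !mxE /=.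
rewrite !ffunE !(tnth_nth u) /= /bump /=.
ring.
Qed.

(* The terms (i, j) and (j, i) of the first and third kinds are equal, and
   those with i = j vanish, so the left-hand side is twice an element of the
   exterior cube: the equation is void when K has characteristic 2. *)
Definition r_matrix (br : g -> g -> g) n (x y : 'I_n -> g) :=
  \sum_(i < n) \sum_(j < n)
    (wedge [tuple br (x i) (x j); y i; y j]
     + wedge [tuple x i; br (y i) (x j); y j] *+ 2
     + wedge [tuple x i; x j; br (y i) (y j)]) = 0.

End RMatrix.

Section KahlerStructures.
Context (K : fieldType) (A : comAlgType K) (g : vectType K).
Context (lam : g -> der A) (n : nat) (x y : 'I_n -> g).
Context (Omega : lmodType A) (d : A -> Omega).

Definition poisson (a b : A) : A :=
  \sum_(i < n) (lam (x i) a * lam (y i) b - lam (x i) b * lam (y i) a).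

(* The elements of Omega being finite sums of terms a du, formulas given on
   these terms are meant to be extended additively. *)
Definition biadditive (op : Omega -> Omega -> Omega) :=
  (forall X, {morph op X : Y Z / Y + Z}) /\
  (forall Z, {morph op^~ Z : X Y / X + Y}).

Definition is_sharp (sharp : Omega -> der A) :=
  {morph sharp : X Y / X + Y} /\
  forall a u v : A, sharp (a *: d u) v = a * poisson u v.

Definition is_kahler_product (op : Omega -> Omega -> Omega) :=
  biadditive op /\
  forall a u b v : A,
    op (a *: d u) (b *: d v) =
      (a * b) *: (\sum_(i < n) (lam (x i) u *: d (lam (y i) v)
                                - lam (y i) u *: d (lam (x i) v)))
      + (a * poisson u b) *: d v.

Definition is_kahler_bracket (br : Omega -> Omega -> Omega) :=
  biadditive br /\
  forall a u b v : A,
    br (a *: d u) (b *: d v) =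
      (a * poisson u b) *: d v + (b * poisson a v) *: d u
      + (a * b) *: d (poisson u v).

End KahlerStructures.

(* Main.v *)
Require Import Defs.
From HB Require Import structures.
From mathcomp Require Import all_boot all_order all_algebra.
From mathcomp Require Import boolp functions.
From mathcomp Require Import ring.

(** The formulas of the statement only describe the anchor and the product on
    generators [a *: d u]; the proof rewrites them without generators.  For [u]
    in the Lie algebra [g] let [iota u : Omega -> A] be the contraction with the
    derivation [lam u], and [L u : Omega -> Omega] the Lie derivative.  If
    [sum_a e_a (x) f_a] is the skew tensor of the bivector
    [r = sum_i x_i /\ y_i], then

      [X . Y = sum_a iota e_a X *: L f_a Y]  and
      [sharp X b = sum_a iota e_a X * lam f_a b].

    In this form the two maps are well defined, since [iota u] and [L u] come
    from the universal property of [Omega] ([contraction_exists],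
    [lie_derivative_exists]), and they are unique because [Omega] is spanned by
    the terms [a *: d u] ([kahler_ind]).

    Both formulas are instances of one construction: one-forms act on every
    [A]-module [M] with a compatible action [rho] of [g] by
    [X . m = sum_a iota e_a X *: rho f_a m].  The Leibniz rule and the Cartan
    formula [iota [u, v] = lam u \o iota v - iota v \o L u] give
    ([r_action_associator])

      [X . (Y . m) - (X . Y) . m
        = sum_(a, b) (iota e_a X * iota [f_a, e_b] Y *: rho f_b m
                      + iota e_a X * iota e_b Y *: rho f_a (rho f_b m))]

    and antisymmetrizing in [X] and [Y] leaves the value of the trilinear map
    [iota u X * iota v Y *: rho w m] on

      [sum_(a, b) ([e_a, e_b] (x) f_a (x) f_b + e_a (x) [f_a, e_b] (x) f_b
                   + e_a (x) e_b (x) [f_a, f_b])],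

    the left-hand side of the classical Yang-Baxter equation.  Twice this tensor
    is the r-matrix expression embedded in the tensor cube, so it vanishes when
    2 is invertible ([r_matrix_yang_baxter]).  Taking [M = Omega] gives the
    pre-Lie identity, and [M = A] the compatibility of the anchor with
    commutators.  The remaining axioms follow from the Leibniz rules, and the
    sub-adjacent bracket is computed on generators. *)

Set Implicit Arguments.
Unset Strict Implicit.
Unset Printing Implicit Defensive.

Import GRing.Theory.
Local Open Scope ring_scope.

(** * Calculus with a single derivation of the algebra *)
Section DerivationRules.
Context (K : fieldType) (A : comAlgType K).
Implicit Types (D : der A) (a b : A).

Lemma derP D : derivation (D : A -> A^o).
Proof. by case: D => D /= /asboolP. Qed.

Lemma der_inj D1 D2 : (forall a, D1 a = D2 a) -> D1 = D2.
Proof. by move=> eqD; apply/val_inj/funext. Qed.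

Lemma derD D a b : D (a + b) = D a + D b.
Proof. exact: derivationD (derP D) a b. Qed.

Lemma derM D a b : D (a * b) = b * (D a : A) + a * (D b : A) :> A.
Proof. exact: (derP D).2. Qed.

Lemma der1 D : D 1 = 0.
Proof.
by apply: (@addrI _ (D 1)); rewrite -[in RHS](mulr1 1) derM !mul1r addr0.
Qed.

Lemma der_scalar D (k : K) : D k%:A = 0.
Proof. by rewrite (derivationZ (derP D)) der1 scaler0. Qed.

Lemma derZ D (k : K) a : D (k *: a) = k *: (D a : A) :> A.
Proof. by rewrite (derivationZ (derP D)) -[RHS]mulr_algl. Qed.

End DerivationRules.

(** * Kähler differentials are generated by exact forms *)
Section KahlerSpan.
Context (K : fieldType) (A : comAlgType K) (Omega : lmodType A).
Context (d : A -> Omega).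

(** The additive span of the terms [a *: d u], encoded by its induction
    principle so that elements need not be exhibited as explicit sums. *)
Definition kahler_span : {pred Omega} := fun w => `[< forall P : Omega -> Prop,
  (forall v1 v2, P v1 -> P v2 -> P (v1 + v2)) -> (forall a u, P (a *: d u)) ->
  P w >].

Fact kahler_span_submod_closed : submod_closed kahler_span.
Proof.
split=> [|a v w /asboolP v_span /asboolP w_span]; apply/asboolP => P PD Pd.
  by rewrite -(scale0r (d 0)).
apply: (PD); last exact: w_span P PD Pd.
apply: (v_span (fun v => P (a *: v))) => [v1 v2 P1 P2|b u].
  by rewrite scalerDr; exact: PD.
by rewrite scalerA.
Qed.

HB.instance Definition _ :=
  GRing.isSubmodClosed.Build A Omega kahler_span
    (GRing.subsemimod_closed_submod kahler_span_submod_closed).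

Record span_sub := SpanSub {
  span_val :> Omega; span_valP : span_val \in kahler_span }.

HB.instance Definition _ := [isSub for span_val].
HB.instance Definition _ := [Choice of span_sub by <:].
HB.instance Definition _ := [SubChoice_isSubLmodule of span_sub by <:].

Hypothesis hd : kahler_differentials d.

(** The two maps are both factorizations of the same derivation
    [fun a => f1 (d a)], so the uniqueness half of the universal property
    identifies them. *)
Lemma kahler_linear_ext (M : lmodType A) (f1 f2 : {linear Omega -> M}) :
  (forall a, f1 (d a) = f2 (d a)) -> f1 =1 f2.
Proof.
move=> eqf.
have dD (f : {linear Omega -> M}) : derivation (fun a => f (d a)).
  split=> [k a b | a b]; last by rewrite hd.1.2 linearD !linearZ.
  by rewrite (derivationD hd.1) (derivationZ hd.1) linearP.
have [f _ uniq_f] := hd.2 _ _ (dD f1).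
by move=> w; rewrite (uniq_f f1) ?(uniq_f f2).
Qed.

(** The derivation [d] already takes its values in the span of the [a *: d u].
    The universal property factors it through a linear map from [Omega] to this
    submodule, whose composite with the inclusion fixes every [d u], hence is
    the identity: the span is all of [Omega]. *)
Lemma kahler_ind (P : Omega -> Prop) :
  (forall v w, P v -> P w -> P (v + w)) -> (forall a u, P (a *: d u)) ->
  forall w, P w.
Proof.
move=> PD Pd w.
have d_span u : d u \in kahler_span.
  by apply/asboolP => Q _ Qd; rewrite -(scale1r (d u)).
pose dS u := SpanSub (d_span u).
have derS : derivation dS.
  split=> [k a b | a b]; apply: val_inj => /=; last exact: hd.1.2.
  by rewrite (derivationD hd.1) (derivationZ hd.1).
have [f fd _] := hd.2 _ _ derS.
have /(_ w) /= fw := @kahler_linear_ext _ (val \o f) idfun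
  (fun a => congr1 val (fd a)).
by have /asboolP := valP (f w); rewrite [val _]fw; apply.
Qed.

End KahlerSpan.

(** * Lie derivatives of differential forms *)
Section LieDerivative.
Context (K : fieldType) (A : comAlgType K) (Omega : lmodType A).
Context (D : der A).

(** First-order jets: pairs [(w, w')] on which [a] acts as multiplication by the
    dual number [a + eps * D a].  A map satisfying the Leibniz rule over [D] is
    thus turned into an [A]-linear map, namely [w |-> (w, L w)]. *)
Definition twisted : Type := (Omega * Omega)%type.
HB.instance Definition _ := GRing.Zmodule.on twisted.

Definition twisted_scale (a : A) (p : twisted) : twisted :=
  (a *: p.1, a *: p.2 + (D a : A) *: p.1).

Fact twisted_scaleA a b p :
  twisted_scale a (twisted_scale b p) = twisted_scale (a * b) p.
Proof.
rewrite /twisted_scale /= !scalerA; congr pair.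
by rewrite scalerDr !scalerA -addrA -scalerDl derM addrC (mulrC b) addrC
  [X in _ + X *: _]addrC.
Qed.

Fact twisted_scale1 : left_id 1 twisted_scale.
Proof.
move=> p; rewrite /twisted_scale -(scale1r 1) der_scalar scale0r addr0 !scale1r.
by case: p.
Qed.

Fact twisted_scaleDr : right_distributive twisted_scale +%R.
Proof.
by move=> a p q; congr pair; rewrite /= !scalerDr // addrACA.
Qed.

Fact twisted_scaleDl p : {morph twisted_scale^~ p : a b / a + b}.
Proof.
by move=> a b; congr pair; rewrite /= ?derD !scalerDl // addrACA.
Qed.

HB.instance Definition _ := GRing.Zmodule_isLmodule.Build A twisted
  twisted_scaleA twisted_scale1 twisted_scaleDr twisted_scaleDl.

(** The Lie derivative is not [A]-linear, so the universal property does not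
    produce it directly.  It applies to the derivation
    [a |-> (d a, d (D a))] into the jets; the first component of the resulting
    linear map is the identity, and the second one is the Lie derivative. *)
Lemma lie_derivative_exists (d : A -> Omega) (hd : kahler_differentials d) :
  exists L : Omega -> Omega,
    [/\ {morph L : v w / v + w},
        forall (a : A) w, L (a *: w) = a *: L w + (D a : A) *: w &
        forall a, L (d a) = d (D a)].
Proof.
pose j a : twisted := (d a, d (D a)).
have dD := derivationD hd.1; have dZ := derivationZ hd.1.
have der_j : derivation j.
  split=> [k a b | a b].
    congr pair; rewrite /= ?derD ?derZ dD dZ //=.
    by rewrite der1 scaler0 scale0r addr0.
  congr pair; rewrite /= ?derM ?dD !hd.1.2 //.
  by rewrite -addrA addrC !addrA.
have [f fj _] := hd.2 _ _ der_j.
have f1 w : (f w).1 = w.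
  elim/(kahler_ind hd): w => [v w fv fw|a u]; last by rewrite linearZ /= fj.
  by rewrite linearD /= fv fw.
exists (fun w => (f w).2); split=> [v w | a w | a].
- by rewrite linearD.
- by rewrite linearZ /= f1.
- by rewrite fj.
Qed.

End LieDerivative.

(** * Contracting bilinear expressions with the bivector *)
Section SkewSum.
Context (g : Type) (n : nat) (x y : 'I_n -> g).

(** Evaluation of [B] on the skew tensor of the bivector [sum_i x_i /\ y_i]. *)
Definition skew_sum (W : zmodType) (B : g -> g -> W) : W :=
  \sum_(i < n) (B (x i) (y i) - B (y i) (x i)).

Lemma eq_skew_sum (W : zmodType) (B1 B2 : g -> g -> W) :
  (forall u v, B1 u v = B2 u v) -> skew_sum B1 = skew_sum B2.
Proof. by move=> eqB; apply: eq_bigr => i _; rewrite !eqB. Qed.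

Lemma skew_sum_morph (W1 W2 : zmodType) (f : W1 -> W2) (B : g -> g -> W1) :
  {morph f : w1 w2 / w1 + w2} ->
  f (skew_sum B) = skew_sum (fun u v => f (B u v)).
Proof.
move=> fD; have f0 : f 0 = 0 by apply: (@addrI _ (f 0)); rewrite -fD !addr0.
have fN w : f (- w) = - f w.
  by apply: (@addrI _ (f w)); rewrite -fD !subrr f0.
by rewrite (big_morph f fD f0); apply: eq_bigr => i _; rewrite fD fN.
Qed.

Lemma skew_sumN (W : zmodType) (B : g -> g -> W) :
  - skew_sum B = skew_sum (fun u v => - B u v).
Proof. exact: (skew_sum_morph _ (@opprD W)). Qed.

Lemma skew_sumD (W : zmodType) (B1 B2 : g -> g -> W) :
  skew_sum B1 + skew_sum B2 = skew_sum (fun u v => B1 u v + B2 u v).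
Proof.
by rewrite -big_split; apply: eq_bigr => i _; rewrite opprD addrACA.
Qed.

Lemma skew_sum_flip (W : zmodType) (B : g -> g -> W) :
  skew_sum (fun u v => B v u) = - skew_sum B.
Proof. by rewrite -sumrN; apply: eq_bigr => i _; rewrite opprB. Qed.

Lemma skew_sum_exchange (W : zmodType) (B : g -> g -> g -> g -> W) :
  skew_sum (fun u v => skew_sum (B u v)) =
  skew_sum (fun u' v' => skew_sum (fun u v => B u v u' v')).
Proof.
rewrite /skew_sum; under eq_bigr => i _ do rewrite -sumrB.
under [RHS]eq_bigr => i _ do rewrite -sumrB.
rewrite exchange_big; apply: eq_bigr => i _; apply: eq_bigr => j _.
by rewrite !opprB addrACA [X in _ + X = _]addrC [RHS]addrACA.
Qed.

End SkewSum.

(** * The classical Yang-Baxter equation *)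
Section YangBaxter.
Context (K : fieldType) (g : vectType K) (br : g -> g -> g).
Context (n : nat) (x y : 'I_n -> g).

(** With [sum_a e_a (x) f_a] the skew tensor of the bivector, this is the value
    of [phi] on the left-hand side of the classical Yang-Baxter equation
    [[r12, r13] + [r12, r23] + [r13, r23]]. *)
Definition yang_baxter_sum (W : zmodType) (phi : g -> g -> g -> W) : W :=
  skew_sum x y (fun u v => skew_sum x y (fun u' v' =>
    phi (br u u') v v' + phi u (br v u') v' + phi u u' (br v v'))).

Lemma eq_yang_baxter_sum (W : zmodType) (phi1 phi2 : g -> g -> g -> W) :
  (forall u v w, phi1 u v w = phi2 u v w) ->
  yang_baxter_sum phi1 = yang_baxter_sum phi2.
Proof.
by move=> eqphi; apply: eq_skew_sum => u v; apply: eq_skew_sum => u' v';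
  rewrite !eqphi.
Qed.

Lemma yang_baxter_sum_morph (W1 W2 : zmodType) (f : W1 -> W2)
    (phi : g -> g -> g -> W1) : {morph f : w1 w2 / w1 + w2} ->
  f (yang_baxter_sum phi) = yang_baxter_sum (fun u v w => f (phi u v w)).
Proof.
move=> fD; rewrite !(skew_sum_morph _ _ _ fD); apply: eq_skew_sum => u v.
by rewrite (skew_sum_morph _ _ _ fD); apply: eq_skew_sum => u' v'; rewrite !fD.
Qed.

Lemma yang_baxter_sum_sum (W : zmodType) (I : finType)
    (phi : I -> g -> g -> g -> W) :
  yang_baxter_sum (fun u v w => \sum_i phi i u v w) =
  \sum_i yang_baxter_sum (phi i).
Proof.
rewrite /yang_baxter_sum /skew_sum.
under [RHS]eq_bigr => i _ do under eq_bigr => j _ do rewrite -sumrB.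
rewrite [RHS]exchange_big; apply: eq_bigr => j _.
rewrite -sumrB [RHS]exchange_big; apply: eq_bigr => k _.
by rewrite !(sumrB, big_split).
Qed.

Lemma wedge3E (u v w : g) (p q r : 'I_(\dim {:g})) :
  let c i : g -> K := coord (vbasis {:g}) i in
  wedge [tuple u; v; w] [ffun m => tnth [tuple p; q; r] m] =
    c p u * (c q v * c r w - c r v * c q w)
  - c q u * (c p v * c r w - c r v * c p w)
  + c r u * (c p v * c q w - c q v * c p w).
Proof.
rewrite !ffunE (expand_det_row _ ord0) !big_ord_recl big_ord0 /cofactor.
rewrite !(expand_det_row _ ord0) !big_ord_recl !big_ord0 /cofactor !det_mx11.
rewrite !mxE /= !ffunE !(tnth_nth u) !(tnth_nth p) /= /bump /=.
ring.
Qed.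

Hypothesis two_neq0 : 2%:R != 0 :> K.
Hypothesis br_lie : lie_bracket br.
Hypothesis r_rmatrix : r_matrix br x y.

Lemma lie_bracket_anti u v : br v u = - br u v.
Proof.
have [[brr brl] br0 _] := br_lie; have := br0 (1 *: u + v).
rewrite brl !brr !br0 !scale1r addr0 add0r => /eqP.
by rewrite addrC addr_eq0 => /eqP.
Qed.

(** Summed over all pairs, the r-matrix expression is twice the Yang-Baxter
    tensor, but not pair by pair.  In the coordinates [p], [q], [r], let [E i j]
    be the summand of the former and [C i j] the one of the latter; antisymmetry
    of the bracket only gives [E i j + E j i = 2 (C i j + C j i)].  Hence
    [4 * sum C = 2 * sum E = 0]. *)
Lemma r_matrix_coord (p q r : 'I_(\dim {:g})) :
  let c i : g -> K := coord (vbasis {:g}) i in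
  yang_baxter_sum (fun u v w => c p u * c q v * c r w) = 0.
Proof.
move=> c.
have cN i u : c i (- u) = - c i u by rewrite /c linearN.
pose S (G : 'I_n -> 'I_n -> K) := \sum_i \sum_j G i j.
have SD G H : S (fun i j => G i j + H i j) = S G + S H.
  by rewrite /S -big_split; apply: eq_bigr => i _; rewrite -big_split.
have S_sym G : S (fun i j => G i j + G j i) = S G + S G.
  by rewrite SD; congr (_ + _); rewrite /S exchange_big.
have eqS G H : (forall i j, G i j = H i j) -> S G = S H.
  by move=> eqGH; do 2 (apply: eq_bigr => ? _); rewrite eqGH.
pose s : {ffun 'I_3 -> 'I_(\dim {:g})} := [ffun m => tnth [tuple p; q; r] m].
pose w3 u v w := wedge [tuple u; v; w] s.
pose E i j := w3 (br (x i) (x j)) (y i) (y j) +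
  w3 (x i) (br (y i) (x j)) (y j) *+ 2 + w3 (x i) (x j) (br (y i) (y j)).
pose psi u v w := c p u * c q v * c r w.
pose T u v u' v' := psi (br u u') v v' + psi u (br v u') v' + psi u u' (br v v').
pose C i j := T (x i) (y i) (x j) (y j) - T (x i) (y i) (y j) (x j)
  - (T (y i) (x i) (x j) (y j) - T (y i) (x i) (y j) (x j)).
have SE0 : S E = 0.
  have := congr1 (fun h : {ffun {ffun 'I_3 -> 'I_(\dim {:g})} -> K} => h s)
    (r_rmatrix : _ = 0).
  rewrite sum_ffunE [RHS]ffunE => <-; apply: eq_bigr => i _.
  rewrite sum_ffunE; apply: eq_bigr => j _.
  by rewrite [RHS]ffunE; congr (_ + _); rewrite [RHS]ffunE ffunMnE.
have EC i j : E i j + E j i = (C i j + C j i) * 2%:R.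
  rewrite /E /w3 !wedge3E -/(c p) -/(c q) -/(c r) /C /T /psi.
  rewrite (lie_bracket_anti (y j) (x i)) (lie_bracket_anti (x i) (x j)).
  rewrite (lie_bracket_anti (y i) (x j)) (lie_bracket_anti (y i) (y j)).
  rewrite !cN.
  ring.
have -> : yang_baxter_sum psi = S C.
  by apply: eq_bigr => i _; rewrite -sumrB.
have := eqS _ _ EC; rewrite S_sym SE0 addr0.
rewrite (eqS _ (fun i j => (C i j + C j i) + (C i j + C j i))) => [|i j].
  rewrite SD S_sym -!mulr2n -mulr_natl -[S C *+ 2]mulr_natl => /esym/eqP.
  by rewrite !mulf_eq0 (negbTE two_neq0) => /eqP.
by rewrite mulr_natr mulr2n.
Qed.

(** The form of the r-matrix hypothesis that is used below, for an arbitrary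
    trilinear map: such a map is a combination of products of three
    coordinates. *)
Lemma r_matrix_yang_baxter (W : lmodType K) (phi : g -> g -> g -> W) :
  (forall u v, linear (phi u v)) -> (forall u w, linear (phi u ^~ w)) ->
  (forall v w, linear (fun u => phi u v w)) ->
  yang_baxter_sum phi = 0.
Proof.
move=> phi3 phi2 phi1; pose b := vbasis {:g}; pose c := coord b.
have linE (f : g -> W) (lf : linear f) u : f u = \sum_p c p u *: f b`_p.
  pose fL := HB.pack_for {linear g -> W} f (GRing.isLinear.Build _ _ _ _ f lf).
  rewrite {1}(coord_vbasis (memvf u)) -[f]/(fL : _ -> _) linear_sum.
  by apply: eq_bigr => i _; rewrite linearZ.
have -> : yang_baxter_sum phi = yang_baxter_sum (fun u v w =>
    \sum_p \sum_q \sum_r (c p u * c q v * c r w) *: phi b`_p b`_q b`_r).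
  apply: eq_yang_baxter_sum => u v w.
  rewrite (linE _ (phi1 v w)); apply: eq_bigr => p _.
  rewrite (linE _ (phi2 _ w)) scaler_sumr; apply: eq_bigr => q _.
  rewrite (linE _ (phi3 _ _)) !scaler_sumr; apply: eq_bigr => r _.
  by rewrite !scalerA.
rewrite yang_baxter_sum_sum big1 // => p _.
rewrite yang_baxter_sum_sum big1 // => q _.
rewrite yang_baxter_sum_sum big1 // => r _.
rewrite -(yang_baxter_sum_morph (f := fun k => k *: phi b`_p b`_q b`_r)).
  by rewrite r_matrix_coord scale0r.
by move=> k l; rewrite scalerDl.
Qed.

End YangBaxter.

Lemma restr_scaleE (K : fieldType) (A : comAlgType K) (M : lmodType A)
  (k : K) (m : M) : k *: (m : restr M) = k%:A *: m.
Proof. by []. Qed.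

(** * The action of one-forms on equivariant modules *)
Section EquivariantModules.
Context (K : fieldType) (A : comAlgType K) (g : vectType K).
Context (br : g -> g -> g) (lam : g -> der A).

(** The Lie algebra acts on [M] compatibly with its action [lam] on [A].  Both
    [A] itself and the one-forms, with the Lie derivatives, are of this kind. *)
Definition equivariant_module (M : lmodType A) (rho : g -> M -> M) :=
  [/\ forall u, {morph rho u : m1 m2 / m1 + m2},
      forall u (a : A) m, rho u (a *: m) = a *: rho u m + (lam u a : A) *: m,
      forall (k : K) u v m,
        rho (k *: u + v) m = k%:A *: rho u m + rho v m &
      forall u v m, rho (br u v) m = rho u (rho v m) - rho v (rho u m)].

(** An [A]-linear pairing between the Lie algebra and [Omega] that satisfies the
    Cartan formula for the Lie derivatives [L]. *)
Definition equivariant_contraction (Omega : lmodType A)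
    (L : g -> Omega -> Omega) (iota : g -> Omega -> A) :=
  [/\ forall u, {morph iota u : X Y / X + Y},
      forall u a X, iota u (a *: X) = a * iota u X,
      forall (k : K) u v X,
        iota (k *: u + v) X = k%:A * iota u X + iota v X &
      forall u v X, iota (br u v) X = lam u (iota v X) - iota v (L u X)].

Context (hK : 2%:R != 0 :> K) (hbr : lie_bracket br).
Context (n : nat) (x y : 'I_n -> g) (hr : r_matrix br x y).
Context (Omega : lmodType A) (L : g -> Omega -> Omega) (iota : g -> Omega -> A).
Hypothesis hiota : equivariant_contraction L iota.

(** On [M := Omega] this is the pre-Lie product, and on [M := A] it is the
    derivation given by the anchor: both contract the form with the first leg of
    the bivector and let the second leg act. *)
Definition r_action (M : lmodType A) (rho : g -> M -> M) (X : Omega) (m : M) :=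
  skew_sum x y (fun u v => iota u X *: rho v m).

(** When [X] acts on [Y . m], the Leibniz rule differentiates the coefficient
    [iota u' Y].  Subtracting [(X . Y) . m] trades that derivative for the
    contraction with a Lie bracket, by the Cartan formula
    [iota [v, u'] = lam v \o iota u' - iota u' \o L v]. *)
Lemma r_action_associator (M : lmodType A) (rho : g -> M -> M) :
  equivariant_module rho -> forall X Y m,
  r_action rho X (r_action rho Y m) - r_action rho (r_action L X Y) m =
  skew_sum x y (fun u v => skew_sum x y (fun u' v' =>
    (iota u X * iota (br v u') Y) *: rho v' m
    + (iota u X * iota u' Y) *: rho v (rho v' m))).
Proof.
move=> [rhoD rhoZ _ _] X Y m.
have [iotaD iotaZ _ iota_br] := hiota.
have -> : r_action rho X (r_action rho Y m) = skew_sum x y (fun u v =>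
    skew_sum x y (fun u' v' => iota u X *: rho v (iota u' Y *: rho v' m))).
  apply: eq_skew_sum => u v; rewrite (skew_sum_morph _ _ _ (rhoD v)).
  exact: (skew_sum_morph _ _ _ (scalerDr _)).
have -> : r_action rho (r_action L X Y) m = skew_sum x y (fun u v =>
    skew_sum x y (fun u' v' => iota u' (iota u X *: L v Y) *: rho v' m)).
  rewrite [RHS]skew_sum_exchange; apply: eq_skew_sum => u' v'.
  rewrite (skew_sum_morph _ _ _ (iotaD u')).
  exact: (skew_sum_morph _ _ _ (scalerDl _)).
rewrite skew_sumN skew_sumD; apply: eq_skew_sum => u v.
rewrite skew_sumN skew_sumD; apply: eq_skew_sum => u' v'.
rewrite rhoZ iotaZ iota_br scalerDr !scalerA mulrBr scalerBl.
by rewrite -addrA addrC.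
Qed.

(** The key identity.  Exchanging [X] and [Y] in the associator, and using the
    skewness of the bivector and the relation
    [rho [v, v'] = rho v rho v' - rho v' rho v], the difference becomes the
    Yang-Baxter sum of the trilinear map
    [(u, v, w) |-> iota u X * iota v Y *: rho w m].  For [M := Omega] it is the
    pre-Lie identity; for [M := A] it says that the anchor is compatible with
    commutators. *)
Lemma r_action_associator_sym (M : lmodType A) (rho : g -> M -> M) :
  equivariant_module rho -> forall X Y m,
  r_action rho X (r_action rho Y m) - r_action rho (r_action L X Y) m =
  r_action rho Y (r_action rho X m) - r_action rho (r_action L Y X) m.
Proof.
move=> rho_eq X Y m; apply/eqP; rewrite -subr_eq0 !r_action_associator //.
have [_ _ rho_lin rho_br] := rho_eq.
have [_ _ iota_linl _] := hiota.
pose phi (u v w : g) : restr M := (iota u X * iota v Y) *: rho w m.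
have <- : yang_baxter_sum br x y phi = 0.
  apply: (r_matrix_yang_baxter hK hbr hr) => [u v|u w|v w] k w1 w2 /=.
  - rewrite /phi rho_lin scalerDr restr_scaleE.
    by rewrite !scalerA [k%:A * _]mulrC.
  - rewrite /phi iota_linl restr_scaleE.
    by rewrite mulrDr scalerDl mulrCA scalerA.
  - rewrite /phi iota_linl restr_scaleE.
    by rewrite mulrDl scalerDl -mulrA scalerA.
(* In the associator of (Y, X), a flip of the two legs of the first bivector
   brings the terms in F to the shape of phi, and a swap of the two bivectors
   brings those in G to the shape of the terms of (X, Y). *)
pose SS (F : g -> g -> g -> g -> M) :=
  skew_sum x y (fun u v => skew_sum x y (F u v)).
have SSD F G : SS (fun u v u' v' => F u v u' v' + G u v u' v') = SS F + SS G.
  by rewrite /SS skew_sumD; apply: eq_skew_sum => u v; rewrite skew_sumD.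
have SSN F : SS (fun u v u' v' => - F u v u' v') = - SS F.
  by rewrite /SS skew_sumN; apply: eq_skew_sum => u v; rewrite skew_sumN.
pose F (Z1 Z2 : Omega) u v u' v' := (iota u Z1 * iota (br v u') Z2) *: rho v' m.
pose G (Z1 Z2 : Omega) u v u' v' :=
  (iota u Z1 * iota u' Z2) *: rho v (rho v' m).
rewrite -![skew_sum x y _]/(SS (fun u v u' v' =>
  F _ _ u v u' v' + G _ _ u v u' v')) !SSD.
have -> : SS (F Y X) = - SS (fun u v u' v' => phi (br u u') v v').
  rewrite -[RHS](skew_sum_flip x y); apply: eq_skew_sum => u v.
  by apply: eq_skew_sum => u' v'; rewrite /F /phi mulrC.
have -> : SS (G Y X) =
    SS (fun u v u' v' => (iota u X * iota u' Y) *: rho v' (rho v m)).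
  rewrite /SS skew_sum_exchange; apply: eq_skew_sum => u v.
  by apply: eq_skew_sum => u' v'; rewrite /G mulrC.
rewrite opprD opprK [X in _ + X]addrC addrACA -!SSN -!SSD.
apply/eqP; rewrite -[RHS]/(SS (fun u v u' v' => (phi (br u u') v v' : M) +
  (phi u (br v u') v' : M) + (phi u u' (br v v') : M))).
apply: eq_skew_sum => u v; apply: eq_skew_sum => u' v'.
rewrite /phi /F /G rho_br scalerBr.
by rewrite [LHS]addrC [X in X + _ = _]addrC addrACA.
Qed.

End EquivariantModules.

(** * The sub-adjacent bracket of a pre-Lie product *)
Section SubadjacentBracket.
Context (K : fieldType) (A : comAlgType K) (E : lmodType A).

(** The Jacobi expression is the sum over cyclic permutations of
    [(u, v, w) - (v, u, w)], where each term vanishes by the pre-Lie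
    identity. *)
Lemma pre_lie_commutator_lie (V : lmodType K) (op : V -> V -> V) :
  pre_lie_product op ->
  lie_bracket (fun u v => op u v - op v u).
Proof.
move=> [[opr opl] op_sym]; split.
- split=> u k v w.
    by rewrite opr opl scalerBr opprD addrACA.
  by rewrite opr opl scalerBr opprD addrACA.
- by move=> u; rewrite subrr.
move=> u v w.
have oprB u1 v1 w1 : op u1 (v1 - w1) = op u1 v1 - op u1 w1.
  by rewrite -scaleN1r addrC opr scaleN1r addrC.
have oplB u1 v1 w1 : op (v1 - w1) u1 = op v1 u1 - op w1 u1.
  by rewrite -scaleN1r addrC opl scaleN1r addrC.
have sym0 u1 v1 w1 : associator op u1 v1 w1 - associator op v1 u1 w1 = 0.
  by rewrite op_sym subrr.
have -> : 0 = (associator op u v w - associator op v u w)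
  + (associator op v w u - associator op w v u)
  + (associator op w u v - associator op u w v) by rewrite !sym0 !addr0.
rewrite /associator !oprB !oplB !opprB !addrA.
by rewrite [LHS](ACl (1*12*11*6*5*4*3*10*9*8*7*2)).
Qed.

Lemma subadjacent_lie_rinehart (op : E -> E -> E) (theta : E -> der A) :
  pre_lie_rinehart op theta -> lie_rinehart (subadjacent op) theta.
Proof.
move=> [op_pre_lie theta_lin opZr opZl theta_op]; split=> //.
- exact: pre_lie_commutator_lie op_pre_lie.
- by move=> X a Y; rewrite /subadjacent opZr opZl scalerBr addrAC.
Qed.

End SubadjacentBracket.

(** * The Lie algebra action on one-forms *)
Section KahlerAction.
Context (K : fieldType) (A : comAlgType K) (g : vectType K).
Context (br : g -> g -> g) (lam : g -> der A).
Hypothesis hlam : lie_hom br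
  (@der_commutator K A : restr (der A) -> restr (der A) -> restr (der A))
  (lam : g -> restr (der A)).
Context (Omega : lmodType A) (d : A -> Omega) (hd : kahler_differentials d).

Lemma lie_hom_linE (k : K) u v a :
  lam (k *: u + v) a = k%:A * (lam u a : A) + (lam v a : A) :> A.
Proof. by rewrite (hlam.1 k u v). Qed.

Lemma lie_hom_brE u v a :
  lam (br u v) a = lam u (lam v a) - lam v (lam u a).
Proof. by rewrite hlam.2. Qed.

Lemma contraction_exists : exists iota : g -> Omega -> A,
  [/\ forall u, {morph iota u : X Y / X + Y},
      forall u a X, iota u (a *: X) = a * iota u X &
      forall u a, iota u (d a) = lam u a].
Proof.
have iotaP u : exists f : {linear Omega -> A^o}, forall a, f (d a) = lam u a.
  by have [f fd _] := hd.2 _ _ (derP (lam u)); exists f.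
have [iota iotaE] := choice iotaP.
by exists iota; split=> // u; [exact: linearD | move=> a X; rewrite linearZ].
Qed.

Lemma equivariant_module_base :
  equivariant_module br lam (fun u (a : A^o) => lam u a).
Proof.
split=> [u a b|u a b|k u v a|u v a].
- exact: derD.
- by rewrite [LHS]derM addrC [b * _]mulrC.
- exact: lie_hom_linE.
- exact: lie_hom_brE.
Qed.

Lemma equivariant_module_kahler : exists2 L : g -> Omega -> Omega,
  equivariant_module br lam L & forall u a, L u (d a) = d (lam u a).
Proof.
have [L LP] := choice (fun u => lie_derivative_exists (lam u) hd).
have LD u : {morph L u : X Y / X + Y} by have [] := LP u.
have LZ u (a : A) X : L u (a *: X) = a *: L u X + (lam u a : A) *: X.
  by have [] := LP u.
have Ld u a : L u (d a) = d (lam u a) by have [] := LP u.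
have dD := derivationD hd.1.
exists L => //; split=> // [k u v X|u v X].
- elim/(kahler_ind hd): X => [X Y hX hY|a b].
    by rewrite !LD hX hY scalerDr addrACA.
  rewrite !LZ !Ld !lie_hom_linE dD mulr_algl (derivationZ hd.1).
  rewrite scalerDl !scalerDr -!scalerA [LHS]addrACA.
  by rewrite !scalerA [a * k%:A]mulrC.
- elim/(kahler_ind hd): X => [X Y hX hY|a b].
    by rewrite !LD hX hY opprD addrACA.
  rewrite !(LZ, LD, Ld) !lie_hom_brE dD (derivationN hd.1).
  rewrite scalerBl !scalerBr [X in _ = X - _](AC (2*2) ((1*4)*(2*3))).
  rewrite [X in _ = _ - X](AC (2*2) ((3*2)*(1*4))) addrKA opprD.
  by rewrite addrACA.
Qed.

Lemma equivariant_contraction_kahler (L : g -> Omega -> Omega)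
    (iota : g -> Omega -> A) :
  equivariant_module br lam L -> (forall u a, L u (d a) = d (lam u a)) ->
  (forall u, {morph iota u : X Y / X + Y}) ->
  (forall u a X, iota u (a *: X) = a * iota u X) ->
  (forall u a, iota u (d a) = lam u a) ->
  equivariant_contraction br lam L iota.
Proof.
move=> [LD LZ _ _] Ld iotaD iotaZ iota_d.
split=> // [k u v X|u v X].
- elim/(kahler_ind hd): X => [X Y hX hY|a b].
    by rewrite !iotaD hX hY mulrDr addrACA.
  by rewrite !iotaZ !iota_d lie_hom_linE mulrDr mulrCA.
- elim/(kahler_ind hd): X => [X Y hX hY|a b].
    by rewrite LD !iotaD derD hX hY opprD addrACA.
  rewrite LZ iotaD !iotaZ Ld !iota_d lie_hom_brE derM.
  rewrite mulrBr opprD [lam v b * _]mulrC [X in _ = X + _]addrC.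
  by rewrite [X in _ = _ + X]addrC addrA addrK.
Qed.

End KahlerAction.

(** * Structures determined by their values on generators *)
Section KahlerStructureUniqueness.
Context (K : fieldType) (A : comAlgType K) (g : vectType K).
Context (lam : g -> der A) (n : nat) (x y : 'I_n -> g).
Context (Omega : lmodType A) (d : A -> Omega) (hd : kahler_differentials d).

Lemma poisson_skew_sum a b :
  poisson lam x y a b =
  skew_sum x y (fun u v => (lam u a : A) * (lam v b : A)).
Proof. by apply: eq_bigr => i _; rewrite [X in _ - X]mulrC. Qed.

Lemma poisson_anti a b : poisson lam x y b a = - poisson lam x y a b.
Proof. by rewrite -sumrN; apply: eq_bigr => i _; rewrite opprB. Qed.

Lemma is_sharp_unique (s1 s2 : Omega -> der A) :
  is_sharp lam x y d s1 -> is_sharp lam x y d s2 -> s1 = s2.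
Proof.
move=> [s1D s1E] [s2D s2E]; apply/funext => X.
elim/(kahler_ind hd): X => [X Y hX hY|a u]; first by rewrite s1D s2D hX hY.
by apply: der_inj => v; rewrite s1E s2E.
Qed.

Lemma biadditive_unique (op1 op2 : Omega -> Omega -> Omega) :
  biadditive op1 -> biadditive op2 ->
  (forall a u b v, op1 (a *: d u) (b *: d v) = op2 (a *: d u) (b *: d v)) ->
  op1 = op2.
Proof.
move=> [op1r op1l] [op2r op2l] eqop; apply/funext => X; apply/funext => Y.
elim/(kahler_ind hd): X => [X1 X2 h1 h2|a u]; first by rewrite op1l op2l h1 h2.
by elim/(kahler_ind hd): Y => [Y1 Y2 h1 h2|b v] //; rewrite op1r op2r h1 h2.
Qed.

Lemma is_kahler_product_unique op1 op2 :
  is_kahler_product lam x y d op1 -> is_kahler_product lam x y d op2 ->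
  op1 = op2.
Proof.
move=> [op1D op1E] [op2D op2E]; apply: biadditive_unique => // a u b v.
by rewrite op1E op2E.
Qed.

Lemma is_kahler_bracket_unique br1 br2 :
  is_kahler_bracket lam x y d br1 -> is_kahler_bracket lam x y d br2 ->
  br1 = br2.
Proof.
move=> [br1D br1E] [br2D br2E]; apply: biadditive_unique => // a u b v.
by rewrite br1E br2E.
Qed.

(** The sum in the product formula, antisymmetrized in [u] and [v], is
    [d {u, v}] expanded by the Leibniz rule for [d]. *)
Lemma subadjacent_kahler_bracket op :
  is_kahler_product lam x y d op ->
  is_kahler_bracket lam x y d (subadjacent op).
Proof.
move=> [[opr opl] opE]; split=> [|a u b v].
  split=> [X Y Z|Z X Y]; rewrite /subadjacent opr opl opprD; exact: addrACA.
rewrite /subadjacent !opE (poisson_anti a v) mulrN scaleNr !opprD opprK.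
rewrite [b * a]mulrC addrACA [LHS]addrC; congr (_ + _).
rewrite -scalerBr; congr (_ *: _).
have dD := derivationD hd.1; have d0 := derivation0 hd.1.
rewrite /poisson (big_morph d dD d0) -sumrB; apply: eq_bigr => i _.
rewrite dD (derivationN hd.1) !hd.1.2.
by rewrite opprB addrACA -opprD [X in X - _]addrC.
Qed.

End KahlerStructureUniqueness.

(** * The pre-Lie-Rinehart structure on one-forms *)
Section KahlerPreLie.
Context (K : fieldType) (hK : 2%:R != 0 :> K) (A : comAlgType K).
Context (g : vectType K) (brg : g -> g -> g) (hg : lie_bracket brg).
Context (lam : g -> der A) (n : nat) (x y : 'I_n -> g).
Context (hr : r_matrix brg x y).
Context (Omega : lmodType A) (d : A -> Omega).
Context (L : g -> Omega -> Omega) (iota : g -> Omega -> A).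
Hypothesis lam_eq : equivariant_module brg lam (fun u (a : A^o) => lam u a).
Hypothesis L_eq : equivariant_module brg lam L.
Hypothesis Ld : forall u a, L u (d a) = d (lam u a).
Hypothesis iota_eq : equivariant_contraction brg lam L iota.
Hypothesis iota_d : forall u a, iota u (d a) = lam u a.

Definition r_anchor (X : Omega) : der A :=
  skew_sum x y (fun u v => iota u X *: lam v).

Let op := r_action x y iota L.

Lemma r_anchorE X (a : A) :
  r_anchor X a =
  @r_action _ A g n x y Omega iota A^o (fun u (a : A^o) => lam u a) X a.
Proof.
pose ev (D : der A) : A^o := D a.
have evD : {morph ev : D1 D2 / D1 + D2} by [].
exact: (skew_sum_morph x y _ evD).
Qed.

Lemma r_anchor_linear : linear r_anchor.
Proof.
have [iotaD iotaZ _ _] := iota_eq => a X Y.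
rewrite (skew_sum_morph _ _ _ (scalerDr _)) skew_sumD.
by apply: eq_skew_sum => u v; rewrite iotaD iotaZ scalerDl scalerA.
Qed.

Lemma r_actionDl (X Y Z : Omega) : op (X + Y) Z = op X Z + op Y Z.
Proof.
have [iotaD _ _ _] := iota_eq; rewrite [RHS]skew_sumD.
by apply: eq_skew_sum => u v; rewrite iotaD scalerDl.
Qed.

Lemma r_actionZl (a : A) (X Y : Omega) : op (a *: X) Y = a *: op X Y.
Proof.
have [_ iotaZ _ _] := iota_eq.
rewrite [RHS](skew_sum_morph _ _ _ (scalerDr _)).
by apply: eq_skew_sum => u v; rewrite iotaZ scalerA.
Qed.

Lemma r_actionDr (X Y Z : Omega) : op X (Y + Z) = op X Y + op X Z.
Proof.
have [LD _ _ _] := L_eq; rewrite [RHS]skew_sumD.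
by apply: eq_skew_sum => u v; rewrite LD scalerDr.
Qed.

Lemma r_action_leibniz X (a : A) Y :
  op X (a *: Y) = a *: op X Y + (r_anchor X a : A) *: Y.
Proof.
have [_ LZ _ _] := L_eq; rewrite (skew_sum_morph _ _ _ (scalerDr _)).
rewrite r_anchorE (skew_sum_morph _ _ _ (scalerDl _)) skew_sumD.
apply: eq_skew_sum => u v.
by rewrite LZ scalerDr !scalerA [a * _]mulrC.
Qed.

Lemma r_anchor_is_sharp : is_sharp lam x y d r_anchor.
Proof.
have [_ iotaZ _ _] := iota_eq; split=> [X Y|a u v].
  by have := r_anchor_linear 1 X Y; rewrite !scale1r.
rewrite r_anchorE poisson_skew_sum (skew_sum_morph _ _ _ (mulrDr _)).
by apply: eq_skew_sum => z w; rewrite iotaZ iota_d mulrA.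
Qed.

Lemma r_action_is_kahler_product : is_kahler_product lam x y d op.
Proof.
have [_ iotaZ _ _] := iota_eq; have [_ sharpE] := r_anchor_is_sharp.
split=> [|a u b v].
  by split=> [X Y Z|Z X Y]; [exact: r_actionDr | exact: r_actionDl].
rewrite r_action_leibniz sharpE -scalerA scalerA; congr (_ + _).
rewrite mulrC -scalerA; congr (_ *: _).
transitivity (skew_sum x y (fun z w =>
    a *: ((lam z u : A) *: d (lam w v)))).
  by apply: eq_skew_sum => z w; rewrite iotaZ iota_d Ld scalerA.
by rewrite -(skew_sum_morph _ _ _ (scalerDr _)).
Qed.

(** Both the pre-Lie identity and the compatibility of the anchor come from
    [r_action_associator_sym], applied to the equivariant modules [Omega] and
    [A] respectively. *)
Lemma r_action_pre_lie_rinehart : pre_lie_rinehart op r_anchor.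
Proof.
split.
- split; last exact: (r_action_associator_sym hK hg hr iota_eq L_eq).
  split=> [X k Y Z|Z k X Y]; last by rewrite [LHS]r_actionDl r_actionZl.
  rewrite [LHS]r_actionDr restr_scaleE r_action_leibniz der_scalar scale0r.
  by rewrite addr0.
- exact: r_anchor_linear.
- exact: r_action_leibniz.
- exact: r_actionZl.
move=> X Y; apply: der_inj => a.
have anchorB Z1 Z2 : r_anchor (Z1 - Z2) = r_anchor Z1 - r_anchor Z2.
  by rewrite -scaleN1r addrC r_anchor_linear scaleN1r addrC.
have := r_action_associator_sym hK hg hr iota_eq lam_eq X Y a.
rewrite -!r_anchorE anchorB.
move/(congr1 (fun z => z + (r_anchor (op X Y) a - r_anchor Y (r_anchor X a)))).
by rewrite subrKA [RHS]addrC subrKA => /esym.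
Qed.

End KahlerPreLie.

Theorem proposition3p1
  (K : fieldType) (hK : 2%:R != 0 :> K)
  (A : comAlgType K)
  (g : vectType K) (brg : g -> g -> g) (hg : lie_bracket brg)
  (lam : g -> der A)
  (hlam : lie_hom brg
            (@der_commutator K A : restr (der A) -> restr (der A) -> restr (der A))
            (lam : g -> restr (der A)))
  (n : nat) (x y : 'I_n -> g) (hr : r_matrix brg x y)
  (Omega : lmodType A) (d : A -> Omega) (hd : kahler_differentials d) :
  [/\ exists! sharp : Omega -> der A, is_sharp lam x y d sharp,
      exists! op : Omega -> Omega -> Omega, is_kahler_product lam x y d op,
      exists! br : Omega -> Omega -> Omega, is_kahler_bracket lam x y d br &
      forall (sharp : Omega -> der A) (op br : Omega -> Omega -> Omega),
        is_sharp lam x y d sharp ->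
        is_kahler_product lam x y d op ->
        is_kahler_bracket lam x y d br ->
        [/\ pre_lie_rinehart op sharp,
            lie_rinehart br sharp &
            forall X Y, subadjacent op X Y = br X Y]].
Proof.
have [L L_eq Ld] := equivariant_module_kahler hlam hd.
have [iota [iotaD iotaZ iota_d]] := contraction_exists lam hd.
have iota_eq := equivariant_contraction_kahler hlam hd L_eq Ld iotaD iotaZ iota_d.
have lam_eq := equivariant_module_base hlam.
have sharpP := r_anchor_is_sharp x y iota_eq iota_d.
have opP := r_action_is_kahler_product x y L_eq Ld iota_eq iota_d.
have brP := subadjacent_kahler_bracket hd opP.
have plr := r_action_pre_lie_rinehart hK hg hr lam_eq L_eq iota_eq.
split.
- by exists (r_anchor lam x y iota); split=> // s /(is_sharp_unique hd sharpP).
- by exists (r_action x y iota L); split=> // o /(is_kahler_product_unique hd opP).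
- by exists (subadjacent (r_action x y iota L)); split=> // o
    /(is_kahler_bracket_unique hd brP).
move=> _ _ _ /(is_sharp_unique hd sharpP) <-
  /(is_kahler_product_unique hd opP) <- /(is_kahler_bracket_unique hd brP) <-.
by split=> //; apply: subadjacent_lie_rinehart.
Qed.
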